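(* Let $r>0$, let $L=\{(r\cos\theta,r\sin\theta):0\le\theta\le2\pi\}\subset\mathbb{R}^2$ be the circle of radius $r$ with center $(0,0)$, and let $P$ be the uniform distribution on $L$. Then for every integer $n\ge1$ the set $$\Big\{\Big(r\cos\frac{(j-1)2\pi}{n},\ r\sin\frac{(j-1)2\pi}{n}\Big) : 1\le j\le n\Big\}$$ forms a conditional constrained optimal set of $n$-points for $P$ with respect to the conditional set $\{(r,0)\}$ and the constraint $L$, with conditional constrained quantization error $$V_n=2r^2\Big(1-\frac{n}{\pi}\sin\frac{\pi}{n}\Big).$$
   Context: The uniform distribution $P$ on $L$ is normalized arc length: $dP=\frac{1}{2\pi}\,d\theta$ in the parametrization $\theta\mapsto(r\cos\theta,r\sin\theta)$. Let $d$ be the Euclidean distance on $\mathbb{R}^2$. Let $S\subseteq\mathbb{R}^2$ be a nonempty closed set (the constraint), $\beta\subset\mathbb{R}^2$ a finite set with $\mathrm{card}(\beta)=\ell\ge1$ (the conditional set), and $n\ge\ell$ an integer. The $n$th conditional constrained quantization error for $P$ with respect to $S$ and $\beta$ is $$V_n=V_n(P)=\inf_\alpha\Big\{\int\min_{a\in\alpha\cup\beta}d(x,a)^2\,dP(x) : \alpha\subseteq S,\ 0\le\mathrm{card}(\alpha)\le n-\ell\Big\}.$$ For a finite set $\gamma$ and $a\in\gamma$, the Voronoi region $M(a|\gamma)$ is the set of all $x$ with $d(x,a)=\min_{b\in\gamma}d(x,b)$. A conditional constrained optimal set of $n$-points for $P$ with respect to $S$ and $\beta$ is a set $\alpha\cup\beta$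 with $\alpha$ as in the infimum, attaining the infimum, with $P(M(b|\alpha\cup\beta))>0$ for every $b\in\beta$, and containing at least $\ell$ and at most $n$ elements. Here $S=L$ and $\beta=\{(r,0)\}$. *)

(* Defs.v *)
From HB Require Import structures.
From mathcomp Require Import all_boot all_order all_algebra finmap.
From mathcomp Require Import all_classical all_reals all_analysis.
From mathcomp Require Import measurable_realfun.

Set Implicit Arguments.
Unset Strict Implicit.
Unset Printing Implicit Defensive.
Import Order.TTheory GRing.Theory Num.Theory.
Import numFieldNormedType.Exports.

Local Open Scope fset_scope.
Local Open Scope classical_set_scope.
Local Open Scope ring_scope.

(* The plane is [R * R] with the product (Borel) sigma-algebra. Its canonical
   norm is the max norm, so the Euclidean distance is written out. *)
Definition edist (R : realType) (x y : R * R) : R :=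
  Num.sqrt ((x.1 - y.1) ^+ 2 + (x.2 - y.2) ^+ 2).

(* For nonempty [A] the infimum is attained: it is the minimum of [f] over
   [A]. It is applied to sets containing a nonempty conditional set [beta]. *)
Definition fset_min (R : realType) (T : choiceType) (A : {fset T})
  (f : T -> R) : R := inf [set f a | a in [set` A]].

Definition voronoi (R : realType) (a : R * R) (gamma : {fset R * R}) :
    set (R * R) :=
  [set x | edist x a = fset_min gamma (fun b => edist x b)].

Definition distortion (R : realType) (P : probability (R * R)%type R)
    (gamma : {fset R * R}) : \bar R :=
  (\int[P]_x (fset_min gamma (fun a => edist x a ^+ 2))%:E)%E.

Definition admissible (R : realType) (S : set (R * R)) (beta : {fset R * R})
    (n : nat) : set {fset R * R} :=
  [set alpha | [set` alpha] `<=` S /\ (#|` alpha| <= n - #|` beta|)%N].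

Definition cond_quant_error (R : realType) (P : probability (R * R)%type R)
    (S : set (R * R)) (beta : {fset R * R}) (n : nat) : \bar R :=
  ereal_inf [set distortion P (alpha `|` beta)%fset
            | alpha in admissible S beta n].

Definition cond_optimal_set (R : realType) (P : probability (R * R)%type R)
    (S : set (R * R)) (beta : {fset R * R}) (n : nat)
    (gamma : {fset R * R}) : Prop :=
  exists alpha : {fset R * R},
    [/\ admissible S beta n alpha,
        gamma = (alpha `|` beta)%fset,
        distortion P gamma = cond_quant_error P S beta n,
        (forall b, b \in beta -> (0 < P (voronoi b gamma))%E) &
        (#|` beta| <= #|` gamma| <= n)%N].

Definition circle_pt (R : realType) (r theta : R) : R * R :=
  (r * cos theta, r * sin theta).

Definition circle (R : realType) (r : R) : set (R * R) :=
  [set circle_pt r theta | theta in `[0, 2 * pi]].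

Lemma two_pi_gt0 (R : realType) : 0 < 2 * pi :> R.
Proof. by rewrite mulr_gt0 ?pi_gt0. Qed.

(* [lebesgue_measure] and [uniform_prob] live on [measurableTypeR R], which has
   the sigma-algebra of [R] under another measure display. *)
Definition circle_map (R : realType) (r : R) : measurableTypeR R -> R * R :=
  circle_pt r.

Lemma measurable_circle_map (R : realType) (r : R) :
  measurable_fun [set: measurableTypeR R] (circle_map r).
Proof.
apply: (@measurable_fun_pair _ _ _ (measurableTypeR R) R R
  (fun t => r * cos t) (fun t => r * sin t)).
- apply: (@continuous_measurable_fun R (fun t => r * cos t)) => t.
  apply: cvgM; [exact: cvg_cst | exact: continuous_cos].
- apply: (@continuous_measurable_fun R (fun t => r * sin t)) => t.
  apply: cvgM; [exact: cvg_cst | exact: continuous_sin].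
Qed.

HB.instance Definition _ (R : realType) (r : R) :=
  isMeasurableFun.Build _ _ (measurableTypeR R) (R * R)%type (circle_map r)
    (measurable_circle_map r).

(* Law of [circle_pt r theta] for [theta] uniform between [0] and [2 * pi],
   that is dP = dtheta / (2 * pi). *)
Definition uniform_circle (R : realType) (r : R) :
    probability (R * R)%type R :=
  distribution (uniform_prob (two_pi_gt0 R)) (circle_map r).

(* Main.v *)
(** For every level [D] and every finite set [gamma], pointwise
    [min_a d(x,a)^2 + sum_a max(D - d(x,a)^2, 0) >= D], because the summand of a
    nearest point [a] already makes up for the minimum. Take
    [D = 2 r^2 (1 - cos (pi / n))], the squared distance from a vertex of the
    regular [n]-gon to the middle of an adjacent arc. By rotation invariance
    each integrated summand equals [B = 2 r^2 / pi (sin h - h cos h)], with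
    [h = pi / n], for every [a] on the circle, so at most [n] points have
    distortion at least [D - n B]. For the regular [n]-gon the pointwise
    inequality is an equality on the circle, since at most one vertex is
    closer than the level and some vertex is no farther than it. *)

Require Import Defs.
From HB Require Import structures.
From mathcomp Require Import all_boot all_order all_algebra finmap.
From mathcomp Require Import all_classical all_reals all_analysis.
From mathcomp Require Import measurable_realfun lra.

Set Implicit Arguments.
Unset Strict Implicit.
Unset Printing Implicit Defensive.
Import Order.TTheory GRing.Theory Num.Theory.
Import numFieldNormedType.Exports.

Local Open Scope classical_set_scope.
Local Open Scope ring_scope.

(* The extended distance of mathcomp-analysis has the same name. *)
Local Notation edist := Defs.edist.

(** * Cosine on symmetric arcs and squared chord lengths *)

(** Cosine decreases on [0, pi] and is symmetric about pi, so on the arc from s to 2 pi - s it is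
    largest at the two ends. *)
Lemma ler_cos_sym (R : realType) (s y : R) :
  0 <= s <= pi -> s <= y <= 2 * pi - s -> cos y <= cos s.
Proof.
have cos_decr (u v : R) : 0 <= u -> u <= v -> v <= pi -> cos v <= cos u.
  rewrite le_eqVlt => u0; rewrite le_eqVlt => /predU1P[->//|uv] vpi.
  have u0' : 0 <= u by rewrite le_eqVlt.
  apply/ltW; rewrite ltr_cos// in_itv/= ?u0' ?vpi ?(le_trans (ltW uv)) ?andbT//.
  exact: le_trans u0' (ltW uv).
move=> /andP[s0 spi] /andP[sy ys].
have [ypi|piy] := leP y pi; first exact: cos_decr.
have -> : cos y = cos (2 * pi - y).
  by rewrite -[RHS]cosN opprB -[RHS]cosD2pi; congr cos; lra.
by apply: cos_decr => //; lra.
Qed.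

Lemma edist_sqr (R : realType) (x y : R * R) :
  edist x y ^+ 2 = (x.1 - y.1) ^+ 2 + (x.2 - y.2) ^+ 2.
Proof. by rewrite sqr_sqrtr// addr_ge0// sqr_ge0. Qed.

Lemma edist_circle_pt_sqr (R : realType) (r t u : R) :
  edist (circle_pt r t) (circle_pt r u) ^+ 2 = 2 * r ^+ 2 * (1 - cos (t - u)).
Proof.
rewrite edist_sqr/= cosB; have := cos2Dsin2 t; have := cos2Dsin2 u.
move=> eu et.
(* The squares are grouped so that the Pythagorean identity rewrites each group to 1. *)
transitivity (r ^+ 2 * (cos t ^+ 2 + sin t ^+ 2 + (cos u ^+ 2 + sin u ^+ 2)
  - 2 * (cos t * cos u + sin t * sin u))); first by lra.
by rewrite eu et; lra.
Qed.

(** * Measurability of distances and of finite minima *)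

Lemma measurable_edist_sqr (R : realType) (a : R * R) :
  measurable_fun setT (fun x : R * R => edist x a ^+ 2).
Proof.
under eq_fun do rewrite edist_sqr.
apply: measurable_funD; apply: measurable_funX; apply: measurable_funB => //.
Qed.

Lemma measurable_edist (R : realType) (a : R * R) :
  measurable_fun setT (fun x : R * R => edist x a).
Proof.
rewrite (_ : (fun x => _) = Num.sqrt \o (fun x : R * R => edist x a ^+ 2)).
  apply: measurableT_comp (measurable_edist_sqr a).
  by apply: continuous_measurable_fun; exact: sqrt_continuous.
by apply/funext => x /=; rewrite sqrtr_sqr ger0_norm// sqrtr_ge0.
Qed.

(** A finite nonempty family has a minimizer, whose value is both a member and a lower bound of the
    image. This replaces reasoning about [inf] from here on. *)
Lemma fset_minP (R : realType) (T : choiceType) (A : {fset T}) (f : T -> R) a0 :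
  a0 \in A ->
  exists a, [/\ a \in A, fset_min A f = f a & forall b, b \in A -> f a <= f b].
Proof.
move=> Aa0; pose i0 : A := [` Aa0]%fset.
have [i _ min_i] := arg_minP (fun i : A => f (val i)) (isT : xpredT i0).
exists (val i).
have le_fi b : b \in A -> f (val i) <= f b.
  by move=> Ab; exact: (min_i [` Ab]%fset).
split => //; first exact: valP.
have lb : lbound [set f a | a in [set` A]] (f (val i)).
  by move=> _ [b /= Ab <-]; exact: le_fi.
apply/le_anti/andP; split; last first.
  by apply: lb_le_inf => //; exists (f a0), a0.
apply: ge_inf; first by exists (f (val i)).
by exists (val i) => //; exact: valP.
Qed.

Lemma fset_min_le (R : realType) (T : choiceType) (A : {fset T}) (f : T -> R) a :
  a \in A -> fset_min A f <= f a.
Proof. by move=> Aa; have [b [_ -> ]] := fset_minP f Aa; apply. Qed.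

Lemma measurable_fset_min d (X : measurableType d) (R : realType)
    (T : choiceType) (A : {fset T}) (f : X -> T -> R) a0 :
  a0 \in A -> (forall a, measurable_fun setT (f^~ a)) ->
  measurable_fun setT (fun x => fset_min A (f x)).
Proof.
move=> Aa0 mf.
(* An iterated binary minimum is measurable by induction on the enumeration; the default [f x a0] is
   harmless because [a0] belongs to [A]. *)
rewrite (_ : (fun x => _) =
    fun x => \big[Num.min/f x a0]_(a <- enum_fset A) f x a); last first.
  apply/funext => x; have [a [Aa -> le_fa]] := fset_minP (f x) Aa0.
  apply/le_anti/andP; split; last exact: (bigmin_inf_seq _ a).
  rewrite big_seq; elim/big_ind : _ => //; first exact: le_fa.
  by move=> u v fu fv; rewrite le_min fu.
elim: (enum_fset A) => [|a s ih].
  by under eq_fun do rewrite big_nil; exact: mf.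
by under eq_fun do rewrite big_cons; exact: measurable_minr.
Qed.

(** * Integrals over intervals: translation, splitting, periodicity *)

Section integral_continuous.
Context {R : realType}.
Notation mu := (@lebesgue_measure R).
Implicit Types f : R -> R.

Lemma integral_shift f (a b c : R) : a <= b -> continuous f ->
  (\int[mu]_(x in `[(a + c)%R, (b + c)%R]) (f x)%:E =
   \int[mu]_(x in `[a, b]) (f (x + c)%R)%:E)%E.
Proof.
move=> ab cf; pose F x : R := x + c.
have dF : derive1 F = cst 1.
  by apply/funext => x; rewrite derive1E deriveD// derive_id derive_cst addr0.
have cF : continuous F by move=> x; apply: cvgD; [exact: cvg_id|exact: cvg_cst].
have := @integration_by_substitution_increasing R F f a b ab.
rewrite dF => ->.
- by apply: eq_integral => x _; rewrite !fctE mulr1.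
- by move=> x y _ _; rewrite ltrD2r.
- by move=> x _; exact: cvg_cst.
- exact: is_cvg_cst.
- exact: is_cvg_cst.
- split; [by move=> x _; exact: derivableD| |].
  + exact/cvg_at_right_filter/cF.
  + exact/cvg_at_left_filter/cF.
- exact: continuous_subspaceT.
Qed.

Lemma ge0_integral_itv_split f (a b c : R) : a <= b <= c -> continuous f ->
  (forall x, 0 <= f x) ->
  (\int[mu]_(x in `[a, c]) (f x)%:E =
   \int[mu]_(x in `[a, b]) (f x)%:E + \int[mu]_(x in `[b, c]) (f x)%:E)%E.
Proof.
move=> /andP[ab bc] cf f0.
have mf : measurable_fun setT (fun x => (f x)%:E).
  by apply/measurable_EFinP; exact: continuous_measurable_fun.
(* The right piece drops its endpoint b, a null set, to make the union disjoint. *)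
rewrite -(@integral_itv_obnd_cbnd _ b); last exact: measurable_funTS.
rewrite -ge0_integral_setU//=.
- by rewrite -itv_bndbnd_setU.
- exact: measurable_funTS.
- by move=> x _; rewrite lee_fin.
- apply/disj_setPS => x [/=]; rewrite !in_itv/= => /andP[_ xb] /andP[].
  by rewrite ltNge xb.
Qed.

Lemma ge0_integral_periodic_shift f (T u : R) : continuous f ->
  (forall x, 0 <= f x) -> periodic f T -> 0 <= u <= T ->
  (\int[mu]_(x in `[0%R, T]) (f (x - u)%R)%:E =
   \int[mu]_(x in `[0%R, T]) (f x)%:E)%E.
Proof.
move=> cf f0 fT /andP[u0 uT].
have cfu v : continuous (fun x => f (x - v)).
  move=> x; apply: (@continuous_comp _ _ _ (fun x => x - v) f); last exact: cf.
  by apply: cvgB; [exact: cvg_id|exact: cvg_cst].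
rewrite (@ge0_integral_itv_split _ 0 u T) ?u0//.
rewrite (@ge0_integral_itv_split f 0 (T - u) T) ?subr_ge0 ?uT ?gerBl//.
(* The pieces are matched crosswise: [u, T] translates to [0, T - u], and [0, u] translates to
   [T - u, T] up to one period. *)
rewrite addeC; congr (_ + _)%E.
  have := @integral_shift (fun x => f (x - u)) 0 (T - u) u.
  rewrite add0r subrK subr_ge0 => -> //.
  by apply: eq_integral => x _; rewrite addrK.
have := @integral_shift f 0 u (T - u) u0 cf; rewrite add0r (addrC u) subrK => ->.
by apply: eq_integral => x _; rewrite addrCA addrC fT.
Qed.

End integral_continuous.

(** * The integral of the positive part of cos x - cos h *)

Lemma integral_cosB (R : realType) (a b c : R) : a <= b ->
  (\int[@lebesgue_measure R]_(x in `[a, b]) (cos x - c)%:E =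
   (sin b - sin a - c * (b - a))%:E)%E.
Proof.
rewrite le_eqVlt => /predU1P[<-|ab].
  by rewrite set_itv1 integral_set1; congr (_%:E); lra.
pose F x : R := sin x - c * x.
have dF x : is_derive x (1 : R) F (cos x - c).
  by apply: is_derive_eq; rewrite /GRing.scale/= mulr1.
have cF : continuous F.
  by move=> x; apply/differentiable_continuous/derivable1_diffP; case: (dF x).
rewrite (@continuous_FTC2 R _ F)//.
- by rewrite -EFinB; congr (_%:E); rewrite /F; lra.
- apply: continuous_subspaceT => x.
  by apply: cvgB; [exact: continuous_cos|exact: cvg_cst].
- split; [by move=> x _; case: (dF x)| |].
  + exact/cvg_at_right_filter/cF.
  + exact/cvg_at_left_filter/cF.
- by move=> x _; rewrite derive1E; case: (dF x).
Qed.

Lemma continuous_cosB_pos (R : realType) (c : R) :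
  continuous (fun x : R => Num.max (cos x - c) 0).
Proof.
move=> x; apply: (@continuous_max _ _ (fun x : R => cos x - c) (cst 0)).
  by apply: cvgB; [exact: continuous_cos|exact: cvg_cst].
exact: cvg_cst.
Qed.

(** Over one period the positive part lives on [0, h] and [2 pi - h, 2 pi], and each of these
    contributes sin h - h cos h. *)
Lemma integral_cosB_pos (R : realType) (h : R) : 0 <= h <= pi ->
  (\int[@lebesgue_measure R]_(x in `[0%R, (2 * pi)%R])
     (Num.max (cos x - cos h) 0)%:E
   = (2 * (sin h - h * cos h))%:E)%E.
Proof.
move=> /andP[h0 hpi].
have pi0 := @pi_ge0 R.
set f : R -> R := fun x => Num.max (cos x - cos h) 0.
have f0 x : 0 <= f x by rewrite le_max lexx orbT.
have cf : continuous f by exact: continuous_cosB_pos.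
rewrite (@ge0_integral_itv_split R f 0 h)//; last by lra.
rewrite (@ge0_integral_itv_split R f h (2 * pi - h))//; last by lra.
have -> : (\int[@lebesgue_measure R]_(x in `[0%R, h]) (f x)%:E =
    \int[@lebesgue_measure R]_(x in `[0%R, h]) (cos x - cos h)%:E)%E.
  apply: eq_integral => x /[!inE]/= /[!in_itv]/= /andP[x0 xh].
  by rewrite /f max_l// subr_ge0; apply: ler_cos_sym; lra.
have -> : (\int[@lebesgue_measure R]_(x in `[h, (2 * pi - h)%R]) (f x)%:E =
    0)%E.
  apply: integral0_eq => x /= /[!in_itv]/= /andP[hx xh].
  by rewrite /f max_r// subr_le0 ler_cos_sym//; lra.
have -> : (\int[@lebesgue_measure R]_(x in `[(2 * pi - h)%R, (2 * pi)%R])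
      (f x)%:E =
    \int[@lebesgue_measure R]_(x in `[(2 * pi - h)%R, (2 * pi)%R])
      (cos x - cos h)%:E)%E.
  apply: eq_integral => x /[!inE]/= /[!in_itv]/= /andP[xh x2].
  rewrite /f max_l// subr_ge0.
  have -> : cos x = cos (2 * pi - x).
    by rewrite -[RHS]cosN opprB -[RHS]cosD2pi; congr cos; lra.
  by apply: ler_cos_sym; lra.
rewrite !integral_cosB//; last by lra.
rewrite add0e -EFinD sin0.
have -> : sin (2 * pi : R) = 0 by rewrite mulr_natl sin2pi.
have -> : sin (2 * pi - h) = - sin h.
  by rewrite -sinN -[RHS]sinD2pi; congr sin; lra.
by congr (_%:E); lra.
Qed.

(** * The summands max(D - d(x,a)^2, 0) and their integrals over the circle *)

Definition bump (R : realType) (D : R) (a x : R * R) : R :=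
  Num.max (D - edist x a ^+ 2) 0.

Lemma bump_ge0 (R : realType) (D : R) (a x : R * R) : 0 <= bump D a x.
Proof. by rewrite le_max lexx orbT. Qed.

Lemma measurable_bump (R : realType) (D : R) (a : R * R) :
  measurable_fun setT (bump D a).
Proof.
apply: measurable_maxr; last exact: measurable_cst.
by apply: measurable_funB => //; exact: measurable_edist_sqr.
Qed.

Lemma bump_circle_pt (R : realType) (r h t u : R) :
  bump (2 * r ^+ 2 * (1 - cos h)) (circle_pt r u) (circle_pt r t) =
  2 * r ^+ 2 * Num.max (cos (t - u) - cos h) 0.
Proof.
rewrite /bump edist_circle_pt_sqr maxr_pMr ?mulr0; last first.
  by rewrite mulr_ge0// sqr_ge0.
by congr (Num.max _ 0); lra.
Qed.

Lemma integral_uniform_circle (R : realType) (r : R) (f : R * R -> R) :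
  measurable_fun setT f -> (forall x, 0 <= f x) ->
  (\int[uniform_circle r]_x (f x)%:E = ((2 * pi)^-1)%:E *
    \int[@lebesgue_measure R]_(t in `[0%R, (2 * pi)%R])
      (f (circle_pt r t))%:E)%E.
Proof.
move=> mf f0; rewrite ge0_integral_distribution//; last exact/measurable_EFinP.
rewrite integral_uniform ?subr0//.
- by apply/measurable_EFinP/measurableT_comp => //; exact: measurable_circle_map.
- by move=> x; rewrite lee_fin.
Qed.

(** Rotation invariance: on the circle the summand depends only on t - u, and translating a function
    of period 2 pi leaves its integral over [0, 2 pi] unchanged. *)
Lemma integral_bump (R : realType) (r h u : R) : 0 <= h <= pi ->
  0 <= u <= 2 * pi ->
  (\int[uniform_circle r]_x
     (bump (2 * r ^+ 2 * (1 - cos h)) (circle_pt r u) x)%:E =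
   (2 * r ^+ 2 / pi * (sin h - h * cos h))%:E)%E.
Proof.
move=> hpi u2pi.
rewrite integral_uniform_circle//; last 2 first.
- exact: measurable_bump.
- exact: bump_ge0.
pose f (x : R) := Num.max (cos x - cos h) 0.
have f0 x : 0 <= f x by rewrite le_max lexx orbT.
have cf : continuous f by exact: continuous_cosB_pos.
have cfu : continuous (fun x => f (x - u)).
  move=> x; apply: (@continuous_comp _ _ _ (fun x => x - u) f); last exact: cf.
  by apply: cvgB; [exact: cvg_id|exact: cvg_cst].
under eq_integral do rewrite bump_circle_pt EFinM.
rewrite ge0_integralZl//=; last 2 first.
- by apply/measurable_EFinP/measurable_funTS; exact: continuous_measurable_fun.
- by rewrite lee_fin mulr_ge0// sqr_ge0.
rewrite (@ge0_integral_periodic_shift R f)//; last first.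
  by move=> x; rewrite /f mulr_natl cosD2pi.
rewrite integral_cosB_pos// -!EFinM; congr (_%:E).
by rewrite invfM; lra.
Qed.

(** * The lower bound for an arbitrary finite set *)

(** The pointwise inequality is integrated against a measure of total mass 1. The additive form
    avoids subtracting extended reals. *)
Lemma distortion_ge (R : realType) (P : probability (R * R)%type R) (D : R)
    (gamma : {fset R * R}) a0 : a0 \in gamma ->
  (D%:E <= distortion P gamma +
    \sum_(a <- enum_fset gamma) \int[P]_x (bump D a x)%:E)%E.
Proof.
move=> ga0.
have mF : measurable_fun setT
    (fun x => (fset_min gamma (fun a => edist x a ^+ 2))%:E).
  apply/measurable_EFinP.
  apply: (measurable_fset_min (f := fun x a => edist x a ^+ 2) ga0).
  exact: measurable_edist_sqr.
have mB a : measurable_fun setT (fun x => (bump D a x)%:E).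
  by apply/measurable_EFinP; exact: measurable_bump.
have F0 x : 0 <= fset_min gamma (fun a => edist x a ^+ 2).
  by have [a [_ -> _]] := fset_minP (fun a => edist x a ^+ 2) ga0; exact: sqr_ge0.
rewrite -ge0_integral_sum//; last by move=> a x _; rewrite lee_fin bump_ge0.
rewrite -ge0_integralD//; last 3 first.
- by move=> x _; rewrite lee_fin.
- by move=> x _; apply: sume_ge0 => a _; rewrite lee_fin bump_ge0.
- exact: emeasurable_sum.
(* Monotonicity of the integral is used for nonnegative functions, so a negative level is treated
   apart. *)
have [D0|D0] := leP 0 D; last first.
  apply: le_trans (_ : 0 <= _)%E; first by rewrite lee_fin ltW.
  apply: integral_ge0 => x _; rewrite adde_ge0 ?lee_fin//.
  by apply: sume_ge0 => a _; rewrite lee_fin bump_ge0.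
rewrite -[leLHS]mule1 -(probability_setT P) -integral_cst//.
apply: ge0_le_integral => //.
- by apply: emeasurable_funD => //; exact: emeasurable_sum.
- move=> x _; rewrite sumEFin -EFinD lee_fin.
  (* The summand of a nearest point [a] is at least D - d(x,a)^2; all others are nonnegative. *)
  have [a [ga -> _]] := fset_minP (fun a => edist x a ^+ 2) ga0.
  rewrite (bigD1_seq a) ?fset_uniq//= addrA -[leLHS]addr0 lerD//; last first.
    by apply: sumr_ge0 => b _; exact: bump_ge0.
  by rewrite -lerBlDl le_max lexx.
Qed.

(** * Angles to the vertices and the upper bound for the regular polygon *)

(** With h = pi / n and 1 <= d <= n - 1, the angle s + 2 d h stays between h and 2 pi - h. *)
Lemma cos_vertex_le (R : realType) (n d : nat) (s : R) :
  (0 < d < n)%N -> `|s| <= pi / n%:R ->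
  cos (s + d%:R * (2 * pi) / n%:R) <= cos (pi / n%:R).
Proof.
move=> /andP[d0 dn]; have n0 : (0 < n)%N by exact: leq_ltn_trans dn.
set h := pi / n%:R => /ler_normlP[s1 s2].
have h0 : 0 < h by rewrite divr_gt0 ?pi_gt0 ?ltr0n.
have nh : n%:R * h = pi by rewrite mulrC divfK// pnatr_eq0 -lt0n.
have -> : d%:R * (2 * pi) / n%:R = 2 * (d%:R * h) by rewrite /h; lra.
have d1 : h <= d%:R * h by rewrite ler_peMl ?ler1n// ltW.
have dn1 : d%:R * h + h <= n%:R * h.
  by rewrite -{2}[h]mul1r -mulrDl ler_pM2r// natr1 ler_nat.
rewrite nh in dn1; apply: ler_cos_sym; lra.
Qed.

Lemma cos_nearest_vertex (R : realType) (n : nat) (t : R) :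
  (0 < n)%N -> 0 <= t <= 2 * pi ->
  exists2 i0 : 'I_n, cos (pi / n%:R) <= cos (t - i0%:R * (2 * pi) / n%:R) &
    forall i : 'I_n, i != i0 ->
      cos (t - i%:R * (2 * pi) / n%:R) <= cos (pi / n%:R).
Proof.
move=> n0 /andP[t0 t2pi]; have pi0 := @pi_gt0 R.
set h := pi / n%:R; have h0 : 0 < h by rewrite divr_gt0 ?ltr0n.
have nh : n%:R * h = pi by rewrite mulrC divfK// pnatr_eq0 -lt0n.
have hpi : h <= pi by rewrite -nh ler_peMl ?ler1n// ltW.
have vE (i : nat) : i%:R * (2 * pi) / n%:R = 2 * (i%:R * h) by rewrite /h; lra.
(* Adding one half before truncating rounds t / (2 h) to a nearest integer k, so that t is within h
   of the vertex angle 2 k h. *)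
pose x := t / (2 * h) + 2^-1.
have x0 : 0 <= x by rewrite addr_ge0 ?invr_ge0// divr_ge0// mulr_ge0// ltW.
have xh : x * h = t / 2 + h / 2.
  have hV : h / h = 1 by rewrite divff ?gt_eqF.
  have -> : x * h = t / 2 * (h / h) + h / 2 by rewrite /x invfM; lra.
  by rewrite hV mulr1.
pose k := Num.truncn x; have /andP[kx xk] := truncn_itv x0.
have {kx} kt : 2 * (k%:R * h) - h <= t.
  by have := ler_wpM2r (ltW h0) kx; rewrite xh -/k; lra.
have {xk} tk : t <= 2 * (k%:R * h) + h.
  by have := ler_wpM2r (ltW h0) (ltW xk); rewrite xh -/k -(natr1 k); lra.
have kn : (k <= n)%N.
  rewrite -ltnS -(ltr_nat R) -(ltr_pM2r h0) -(natr1 n) mulrDl nh; lra.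
have st : `|t - 2 * (k%:R * h)| <= h.
  by rewrite ler_norml; apply/andP; split; lra.
have below (i : nat) : (0 < k - i < n)%N ->
    cos (t - i%:R * (2 * pi) / n%:R) <= cos h.
  move=> /[dup] ki /andP[+ _]; rewrite subn_gt0 => ik.
  have := @cos_vertex_le R n (k - i) (t - 2 * (k%:R * h)) ki.
  have -> : t - 2 * (k%:R * h) + (k - i)%:R * (2 * pi) / n%:R =
      t - i%:R * (2 * pi) / n%:R.
    by rewrite !vE natrB ?(ltnW ik)//; lra.
  exact.
have [{}kn|nk] := ltnP k n.
  exists (Ordinal kn) => [|i ik] /=.
    rewrite vE -(cos_norm (t - _)).
    by have := normr_ge0 (t - 2 * (k%:R * h)) => ?; apply: ler_cos_sym; lra.
  have [ltik|leki] := ltnP i k.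
    by apply: below; rewrite subn_gt0 ltik (leq_ltn_trans (leq_subr _ _)).
  have {leki} ki : (k < i)%N by rewrite ltn_neqAle leki andbT eq_sym.
  rewrite -cosN opprB.
  have := @cos_vertex_le R n (i - k) (2 * (k%:R * h) - t).
  have -> : 2 * (k%:R * h) - t + (i - k)%:R * (2 * pi) / n%:R =
      i%:R * (2 * pi) / n%:R - t.
    by rewrite !vE natrB ?(ltnW ki)//; lra.
  apply; first by rewrite subn_gt0 ki (leq_ltn_trans (leq_subr _ _)).
  by rewrite distrC.
(* In the last half step before 2 pi the rounding gives k = n, and this vertex is the one of index
   0. *)
have kE : k = n by apply/eqP; rewrite eqn_leq kn.
exists (Ordinal n0) => [|i i0] /=.
  rewrite mul0r mul0r subr0.
  have -> : cos t = cos (2 * pi - t).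
    by rewrite -[RHS]cosN opprB -[RHS]cosD2pi; congr cos; lra.
  by move: kt; rewrite kE nh => kt; apply: ler_cos_sym; lra.
apply: below; rewrite kE subn_gt0 ltn_ord/= ltn_subrL n0 andbT lt0n.
by apply: contraNneq i0 => i0; apply/eqP/val_inj.
Qed.

(** The sum runs over indices rather than points, so it has exactly n terms without a proof that the
    vertices are distinct. *)
Lemma distortion_regular_le (R : realType) (r : R) (n : nat)
    (gamma : {fset R * R}) (p := fun i : 'I_n =>
      circle_pt r (i%:R * (2 * pi) / n%:R))
    (D := 2 * r ^+ 2 * (1 - cos (pi / n%:R))) :
  (0 < n)%N -> (forall i, p i \in gamma) ->
  (distortion (uniform_circle r) gamma +
    \sum_(i < n) \int[uniform_circle r]_x (bump D (p i) x)%:E <= D%:E)%E.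
Proof.
move=> n0 gp; have g0 := gp (Ordinal n0).
pose F x := fset_min gamma (fun a => edist x a ^+ 2).
have mF : measurable_fun setT F.
  apply: (measurable_fset_min (f := fun x a => edist x a ^+ 2) g0).
  exact: measurable_edist_sqr.
have F0 x : 0 <= F x.
  have [a [_ Fa _]] := fset_minP (fun a => edist x a ^+ 2) g0.
  by rewrite /F Fa sqr_ge0.
have mB a : measurable_fun setT (fun x => (bump D a x)%:E).
  by apply/measurable_EFinP; exact: measurable_bump.
rewrite -ge0_integral_sum//; last by move=> a x _; rewrite lee_fin bump_ge0.
rewrite -ge0_integralD//; last 4 first.
- by move=> x _; rewrite lee_fin; exact: F0.
- exact/measurable_EFinP.
- by move=> x _; apply: sume_ge0 => a _; rewrite lee_fin bump_ge0.
- exact: emeasurable_sum.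
pose G x := F x + \sum_(i < n) bump D (p i) x.
rewrite (eq_integral (fun x => (G x)%:E)); last first.
  by move=> x _; rewrite EFinD sumEFin.
have mG : measurable_fun setT G.
  by apply: measurable_funD => //; apply: measurable_sum => i;
    exact: measurable_bump.
have G0 x : 0 <= G x.
  by rewrite addr_ge0//; apply: sumr_ge0 => i _; exact: bump_ge0.
rewrite integral_uniform_circle//.
have GD t : 0 <= t <= 2 * pi -> G (circle_pt r t) <= D.
  move=> /(cos_nearest_vertex n0)[i0 ci0 ci].
  (* Only vertex [i0] can be closer than the level, so the other summands vanish; its own is D minus
     its squared distance, which bounds the minimum. *)
  rewrite /G (bigD1 i0)//= big1 ?addr0; last first.
    move=> i ii0; rewrite bump_circle_pt max_r ?mulr0// subr_le0; exact: ci.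
  rewrite bump_circle_pt max_l ?subr_ge0//.
  have := fset_min_le (fun a => edist (circle_pt r t) a ^+ 2) (gp i0).
  by rewrite edist_circle_pt_sqr -/(F _) /D; lra.
have D0 : 0 <= D.
  by apply: le_trans (GD 0 _); rewrite ?lexx ?mulr_ge0 ?pi_ge0.
have pi2 := two_pi_gt0 R.
apply: (@le_trans _ _ (((2 * pi)^-1)%:E *
    \int[@lebesgue_measure R]_(t in `[0%R, (2 * pi)%R]) D%:E)%E).
  rewrite lee_pmul2l ?lte_fin ?invr_gt0//.
  apply: ge0_le_integral => //.
  - by move=> t _; rewrite lee_fin.
  - apply/measurable_EFinP/measurable_funTS.
    by apply: (measurableT_comp mG); exact: measurable_circle_map.
rewrite integral_cst//= lebesgue_measure_itv/= lte_fin pi2.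
by rewrite oppr0 adde0 -!EFinM lee_fin mulrCA mulVf ?mulr1 ?gt_eqF.
Qed.

(** * Both bounds in closed form *)

Lemma pi_div_itv (R : realType) (n : nat) :
  (0 < n)%N -> 0 <= (pi : R) / n%:R <= pi.
Proof.
move=> n0; apply/andP; split; first by rewrite divr_ge0 ?pi_ge0.
by rewrite ler_pdivrMr ?ltr0n// ler_peMr ?pi_ge0// ler1n.
Qed.

(** The right side is D - n B; since n h = pi, its cosine terms cancel. *)
Lemma regular_errorE (R : realType) (r : R) (n : nat) (h := pi / n%:R : R) :
  (0 < n)%N ->
  2 * r ^+ 2 * (1 - n%:R / pi * sin h) =
  2 * r ^+ 2 * (1 - cos h) - n%:R * (2 * r ^+ 2 / pi * (sin h - h * cos h)).
Proof.
move=> n0; have nh : n%:R / pi * h = 1.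
  by rewrite /h mulf_div [pi * _]mulrC divff// gt_eqF// mulr_gt0 ?pi_gt0 ?ltr0n.
transitivity (2 * r ^+ 2 * (1 - n%:R / pi * h * cos h) -
  n%:R * (2 * r ^+ 2 / pi * (sin h - h * cos h))); last by rewrite nh mul1r.
by lra.
Qed.

(** Twice this quantity is the integral of a positive part. It gives B >= 0, so sets with fewer than
    n points obey the same lower bound D - n B. *)
Lemma sine_defect_ge0 (R : realType) (h : R) : 0 <= h <= pi ->
  0 <= sin h - h * cos h.
Proof.
move=> hpi; rewrite -(pmulr_rge0 _ (ltr0Sn R 1)) -lee_fin.
rewrite -integral_cosB_pos//; apply: integral_ge0 => x _.
by rewrite lee_fin le_max lexx orbT.
Qed.

Lemma distortion_circle_ge (R : realType) (r : R) (n : nat)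
    (gamma : {fset R * R}) : (0 < #|` gamma| <= n)%N ->
  [set` gamma] `<=` circle r ->
  ((2 * r ^+ 2 * (1 - n%:R / pi * sin (pi / n%:R)))%:E <=
    distortion (uniform_circle r) gamma)%E.
Proof.
move=> /andP[g0 gn] gr; have n0 : (0 < n)%N by exact: leq_trans gn.
have hpi := pi_div_itv R n0.
have /fset0Pn[a0 ga0] : gamma != fset0 by rewrite -cardfs_gt0.
rewrite regular_errorE//; set h := pi / _; set B := 2 * _ / _ * _.
have := distortion_ge (uniform_circle r) (2 * r ^+ 2 * (1 - cos h)) ga0.
rewrite (eq_big_seq (fun=> B%:E)); last first.
  move=> a /gr[u /= /[!in_itv]/= u2pi <-]; exact: integral_bump.
rewrite sumEFin -leeBlDr// -EFinB; apply: le_trans.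
rewrite lee_fin lerB// big_const_seq count_predT iter_addr_0 -[leLHS]mulr_natl.
rewrite ler_wpM2r ?ler_nat// mulr_ge0 ?sine_defect_ge0//.
by rewrite divr_ge0 ?pi_ge0// mulr_ge0// sqr_ge0.
Qed.

Lemma distortion_regular_vertices_le (R : realType) (r : R) (n : nat)
    (gamma : {fset R * R}) : (0 < n)%N ->
  (forall i : 'I_n, circle_pt r (i%:R * (2 * pi) / n%:R) \in gamma) ->
  (distortion (uniform_circle r) gamma <=
    (2 * r ^+ 2 * (1 - n%:R / pi * sin (pi / n%:R)))%:E)%E.
Proof.
move=> n0 gp; have := distortion_regular_le n0 gp.
have hpi := pi_div_itv R n0.
rewrite regular_errorE//; set h := pi / _; set B := 2 * _ / _ * _.
rewrite (eq_bigr (fun=> B%:E)); last first.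
  move=> i _; apply: integral_bump => //.
  rewrite divr_ge0 ?mulr_ge0 ?pi_ge0//= ler_pdivrMr ?ltr0n// mulrC.
  by rewrite ler_wpM2l ?mulr_ge0 ?pi_ge0// ler_nat ltnW.
rewrite sumEFin -leeBrDr// -EFinB => /le_trans; apply.
by rewrite lee_fin lerB// sumr_const card_ord mulr_natl.
Qed.

(** * Positive mass of the Voronoi region of the conditional point *)

Lemma measurable_voronoi (R : realType) (a : R * R) (gamma : {fset R * R}) a0 :
  a0 \in gamma -> measurable (voronoi a gamma).
Proof.
move=> ga0.
have mmin : measurable_fun setT (fun x => fset_min gamma (fun b => edist x b)).
  apply: (measurable_fset_min (f := fun x b => edist x b) ga0).
  exact: measurable_edist.
have := measurable_fun_eqr (measurable_edist a) mmin.
move=> /(_ measurableT [set true]); rewrite setTI.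
rewrite (_ : _ @^-1` _ = voronoi a gamma); first by apply.
by apply/seteqP; split => x /=; [move/eqP|move=> ->; exact: eqxx].
Qed.

(** The region contains the arc of angles [0, h] with h = pi / n, whose mass is h / (2 pi). *)
Lemma voronoi_pos (R : realType) (r : R) (n : nat) (gamma : {fset R * R}) :
  (0 < n)%N -> circle_pt r 0 \in gamma ->
  (forall a, a \in gamma -> exists2 i, (i < n)%N &
    a = circle_pt r (i%:R * (2 * pi) / n%:R)) ->
  (0 < uniform_circle r (voronoi (circle_pt r 0) gamma))%E.
Proof.
move=> n0 g0 gE; have pi0 := @pi_gt0 R.
set h := pi / n%:R : R; have h0 : 0 < h by rewrite divr_gt0 ?ltr0n.
have nh : n%:R * h = pi by rewrite mulrC divfK// pnatr_eq0 -lt0n.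
have hpi : h <= pi by rewrite -nh ler_peMl ?ler1n// ltW.
have hV : `[0, h] `<=` circle_map r @^-1` voronoi (circle_pt r 0) gamma.
  move=> t /= /[!in_itv]/= /andP[t0 th].
  apply/le_anti/andP; split; last exact: fset_min_le.
  have [b [gb -> _]] := fset_minP (fun b => edist (circle_pt r t) b) g0.
  have [i ltin ->] := gE b gb.
  rewrite -(@ler_pXn2r _ 2)// ?nnegrE ?sqrtr_ge0// !edist_circle_pt_sqr.
  rewrite ler_wpM2l//; first by rewrite mulr_ge0// sqr_ge0.
  rewrite lerB// subr0.
  (* For i >= 1 the angle 2 i h - t lies between t and 2 pi - t, because t <= h and 1 <= i <= n -
     1. *)
  have [->|i0] := posnP i; first by rewrite mul0r mul0r subr0.
  rewrite -cosN opprB; apply: ler_cos_sym; first lra.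
  have -> : i%:R * (2 * pi) / n%:R = 2 * (i%:R * h) by rewrite /h; lra.
  have i1 : h <= i%:R * h by rewrite ler_peMl ?ler1n// ltW.
  have i1n : i%:R * h + h <= pi.
    by rewrite -nh -{2}[h]mul1r -mulrDl ler_pM2r// natr1 ler_nat.
  lra.
apply: (@lt_le_trans _ _ (uniform_prob (two_pi_gt0 R) `[0, h])); last first.
  apply: le_measure; rewrite ?inE//.
  rewrite -[X in measurable X]setTI; apply: measurable_circle_map => //.
  exact: measurable_voronoi g0.
rewrite /uniform_prob (eq_integral (fun=> ((2 * pi)^-1)%:E)); last first.
  move=> t /[!inE]/= /[!in_itv]/= /andP[t0 th].
  by rewrite /uniform_pdf subr0 t0 (_ : t <= 2 * pi)//; lra.
rewrite integral_cst//= lebesgue_measure_itv/= lte_fin h0.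
by rewrite oppr0 adde0 -EFinM lte_fin mulr_gt0 ?invr_gt0// mulr_gt0.
Qed.

(** * The regular polygon attains the infimum *)

Theorem theorem4p1p6 (R : realType) (r : R) (n : nat)
    (r_gt0 : 0 < r) (n_ge1 : (1 <= n)%N) :
  cond_optimal_set (uniform_circle r) (circle r) [fset (r, 0)]%fset n
    [fset circle_pt r ((j%:R - 1) * (2 * pi) / n%:R) | j in iota 1 n]%fset /\
  cond_quant_error (uniform_circle r) (circle r) [fset (r, 0)]%fset n =
    (2 * r ^+ 2 * (1 - n%:R / pi * sin (pi / n%:R)))%:E.
Proof.
set gamma := [fset _ | _ in _]%fset; set V := (2 * _ * _)%:E.
have r0E : (r, 0) = circle_pt r 0 by rewrite /circle_pt cos0 sin0 mulr0 mulr1.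
have gE a : a \in gamma -> exists2 i, (i < n)%N &
    a = circle_pt r (i%:R * (2 * pi) / n%:R).
  move=> /imfsetP[[|j]] /=; rewrite mem_iota// add1n ltnS => jn ->.
  by exists j => //; rewrite -natr1 addrK.
have gv (i : 'I_n) : circle_pt r (i%:R * (2 * pi) / n%:R) \in gamma.
  apply/imfsetP; exists i.+1 => /=; first by rewrite mem_iota/= add1n ltnS ltn_ord.
  by rewrite -(natr1 i) addrK.
have g0 : (r, 0) \in gamma.
  by have := gv (Ordinal n_ge1); rewrite /= mul0r mul0r -r0E.
have gcircle : [set` gamma] `<=` circle r.
  move=> _ /gE[i ltin ->]; exists (i%:R * (2 * pi) / n%:R) => //=.
  rewrite in_itv/= divr_ge0 ?mulr_ge0 ?pi_ge0//= ler_pdivrMr ?ltr0n// mulrC.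
  by rewrite ler_wpM2l ?mulr_ge0 ?pi_ge0// ler_nat ltnW.
have gcard : (#|` gamma| <= n)%N.
  rewrite (leq_trans (leq_imfset_card _ _ _))// -[leqRHS](size_iota 1).
  by apply: uniq_leq_size (enum_finmem_uniq _) _ => j; rewrite enum_finmemE.
(* The conditional point is itself a vertex; removing it leaves at most n - 1 free points, exactly
   the allowance. *)
pose alpha := (gamma `\ (r, 0))%fset.
have gammaE : gamma = (alpha `|` [fset (r, 0)])%fset by rewrite fsetUC fsetD1K.
have adm : admissible (circle r) [fset (r, 0)]%fset n alpha.
  split; first by move=> a /= /fsetD1P[_ /gcircle].
  rewrite cardfs1 -(leq_add2r 1) subnK//.
  by move: gcard; rewrite (cardfsD1 (r, 0)) g0 addnC.
have Vle a : admissible (circle r) [fset (r, 0)]%fset n a ->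
    (V <= distortion (uniform_circle r) (a `|` [fset (r, 0%R)])%fset)%E.
  move=> [ar an]; apply: distortion_circle_ge.
    apply/andP; split.
      by rewrite cardfs_gt0; apply/fset0Pn; exists (r, 0); rewrite !inE eqxx orbT.
    rewrite (leq_trans (leq_card_fsetU _ _))// cardfs1.
    by move: an; rewrite cardfs1 -(leq_add2r 1) subnK.
  move=> b /=; rewrite !inE => /orP[/ar//|/eqP ->]; rewrite r0E.
  by exists 0 => //=; rewrite in_itv/= lexx mulr_ge0 ?pi_ge0.
have gV : distortion (uniform_circle r) gamma = V.
  apply/le_anti; rewrite distortion_regular_vertices_le//=.
  by rewrite gammaE Vle.
have errV : cond_quant_error (uniform_circle r) (circle r) [fset (r, 0)]%fset n
    = V.
  (* Every competitor has distortion at least [V], and [alpha] together with the conditional point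
     reaches it. *)
  apply/le_anti/andP; split; last by apply: le_ereal_inf_tmp => _ [a /Vle ? <-].
  by rewrite -gV gammaE; apply: ereal_inf_lbound; exists alpha.
split=> //; exists alpha; split=> //.
- by rewrite gV errV.
- move=> b; rewrite inE => /eqP ->; rewrite r0E.
  by apply: voronoi_pos n_ge1 _ gE; rewrite -r0E.
- by rewrite cardfs1 gcard andbT cardfs_gt0; apply/fset0Pn; exists (r, 0).
Qed.
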